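(* Let $p_0=\int_0^\infty(1+\tau^2+\tau^4)^{-1/2}\,d\tau$ and let $\mathcal{E}:(-p_0,p_0)\to\mathbb{R}$ be the inverse function of $$t\mapsto \xi(t)=\int_0^t\frac{d\tau}{\sqrt{1+\tau^2+\tau^4}},\qquad t\in\mathbb{R}.$$ Then $$\mathcal{E}(u)=\frac{\operatorname{sn}(u,\frac14)\,\operatorname{dn}(u,\frac14)}{\operatorname{cn}(u,\frac14)}$$ for all $u\in(-p_0,p_0)$.
   Context: $\operatorname{sn}(u,m),\operatorname{cn}(u,m),\operatorname{dn}(u,m)$ are the Jacobi elliptic functions in the parameter convention $m=k^2$ (so $\operatorname{dn}^2=1-m\operatorname{sn}^2$). *)

(* Defs.v *)
From Stdlib Require Import Reals.
From Coquelicot Require Import Coquelicot.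
Open Scope R_scope.

(* [inverse f y] is the unique [x] such that [f x = y] (definite description);
   its value is unspecified when there is no such [x] or more than one. *)
Definition inverse (f : R -> R) (y : R) : R :=
  iota (fun x : R => f x = y).

(* The Jacobi elliptic functions of a real argument [u], in the parameter
   convention m = k^2 and for 0 <= m < 1, the range in which the incomplete
   integral of the first kind is an increasing bijection from R to R and the
   amplitude is its inverse. *)
Definition ellipticF (phi m : R) : R :=
  RInt (fun theta => / sqrt (1 - m * (sin theta) ^ 2)) 0 phi.

Definition am (u m : R) : R := inverse (fun phi => ellipticF phi m) u.

Definition sn (u m : R) : R := sin (am u m).
Definition cn (u m : R) : R := cos (am u m).
Definition dn (u m : R) : R := sqrt (1 - m * (sin (am u m)) ^ 2).

Definition xi (t : R) : R :=
  RInt (fun tau => / sqrt (1 + tau ^ 2 + tau ^ 4)) 0 t.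

Definition p0 : R :=
  RInt_gen (fun tau => / sqrt (1 + tau ^ 2 + tau ^ 4))
           (at_point 0) (Rbar_locally p_infty).

(* Meaningful on (-p0, p0), the range of [xi]. *)
Definition calE (u : R) : R := inverse xi u.

(* Main.v *)
(** The substitution [tau = sin theta * dn / cos theta] carries
    [dtau / sqrt (1 + tau^2 + tau^4)] to [dtheta / sqrt (1 - sin^2 theta / 4)]:
    with [x = sin^2 theta], the derivative of [tau] is
    [(1 - x/2 + x^2/4) / ((1 - x) dn)], while [1 + tau^2 + tau^4] is the square
    of [(1 - x/2 + x^2/4) / (1 - x)].  Hence [xi (tau phi) = F (phi | 1/4)] for
    [|phi| < PI/2], and as [tau] maps this interval onto [R], every [u] in the
    range of [xi] is some [F (phi | 1/4)] with [phi = am u] and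
    [calE u = tau phi]. *)

Require Import Defs.
From Stdlib Require Import Reals Lra Ranalysis5.
From Coquelicot Require Import Coquelicot.
Open Scope R_scope.

(** * Injective functions and primitives of continuous functions *)

Lemma inverse_injective (f : R -> R) (x : R) :
  (forall y z, f y = f z -> y = z) -> inverse f (f x) = x.
Proof.
  intros Hf. unfold inverse.
  apply (iota_unique (V := R_CompleteNormedModule)); auto.
Qed.

Lemma strictly_increasing_injective (f : R -> R) :
  (forall x y, x < y -> f x < f y) -> forall x y, f x = f y -> x = y.
Proof.
  intros Hf x y E.
  destruct (Rtotal_order x y) as [H | [H | H]]; auto; apply Hf in H; lra.
Qed.

Lemma ex_RInt_everywhere_continuous (f : R -> R) (a b : R) :
  (forall x, continuous f x) -> ex_RInt f a b.
Proof.
  intros Hf. apply (ex_RInt_continuous (V := R_CompleteNormedModule)). auto.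
Qed.

Lemma is_derive_primitive (f : R -> R) (x : R) :
  (forall x, continuous f x) -> is_derive (fun t => RInt f 0 t) x (f x).
Proof.
  intros Hf. apply is_derive_RInt with (a := 0); auto.
  apply filter_forall. intros y.
  apply (RInt_correct (V := R_CompleteNormedModule)).
  now apply ex_RInt_everywhere_continuous.
Qed.

Lemma primitive_increasing (f : R -> R) (x y : R) :
  (forall x, continuous f x) -> (forall x, 0 < f x) -> x < y ->
  RInt f 0 x < RInt f 0 y.
Proof.
  intros Hc Hp Hxy.
  assert (E := RInt_Chasles (V := R_CompleteNormedModule) f 0 x y
    (ex_RInt_everywhere_continuous f 0 x Hc)
    (ex_RInt_everywhere_continuous f x y Hc)).
  unfold plus in E; simpl in E.
  assert (0 < RInt f x y) by (apply RInt_gt_0; auto).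
  lra.
Qed.

(** * Monotonicity, derivative and oddness of [xi] *)

Lemma xi_radicand_pos (t : R) : 0 < 1 + t ^ 2 + t ^ 4.
Proof. assert (0 <= t ^ 2) by apply pow2_ge_0. nra. Qed.

Lemma continuous_xi_integrand (x : R) :
  continuous (fun tau => / sqrt (1 + tau ^ 2 + tau ^ 4)) x.
Proof.
  apply (ex_derive_continuous (V := R_NormedModule)).
  assert (H := xi_radicand_pos x).
  auto_derive. repeat split; simpl in *; try lra.
  apply Rgt_not_eq, sqrt_lt_R0. simpl in *; lra.
Qed.

Lemma xi_integrand_pos (x : R) : 0 < / sqrt (1 + x ^ 2 + x ^ 4).
Proof. apply Rinv_0_lt_compat, sqrt_lt_R0, xi_radicand_pos. Qed.

Lemma xi_increasing (x y : R) : x < y -> xi x < xi y.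
Proof.
  apply primitive_increasing.
  - exact continuous_xi_integrand.
  - exact xi_integrand_pos.
Qed.

Lemma is_derive_xi (x : R) : is_derive xi x (/ sqrt (1 + x ^ 2 + x ^ 4)).
Proof. exact (is_derive_primitive _ x continuous_xi_integrand). Qed.

Lemma xi_opp (t : R) : xi (- t) = - xi t.
Proof.
  (* Writing the lower limit as [- 0] makes both limits images under [Ropp], ready for the
     substitution; the integrand is even. *)
  unfold xi. rewrite <- Ropp_0 at 1.
  rewrite <- (RInt_comp (V := R_CompleteNormedModule) _ Ropp (fun _ => -1)).
  - rewrite (RInt_ext _ (fun y => opp (/ sqrt (1 + y ^ 2 + y ^ 4)))).
    + apply (RInt_opp (V := R_CompleteNormedModule)).
      apply ex_RInt_everywhere_continuous, continuous_xi_integrand.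
    + intros y _. unfold scal, opp; simpl; unfold mult; simpl.
      replace (1 + - y * (- y * 1) + - y * (- y * (- y * (- y * 1))))
        with (1 + y * (y * 1) + y * (y * (y * (y * 1)))) by ring.
      ring.
  - intros x _. apply continuous_xi_integrand.
  - intros x _. split; [auto_derive; auto; ring | apply continuous_const].
Qed.

(** * The incomplete elliptic integral of the first kind *)

Lemma sin_sq_le_1 (x : R) : 0 <= sin x ^ 2 <= 1.
Proof.
  assert (H := sin2_cos2 x). unfold Rsqr in H.
  assert (0 <= cos x * cos x) by apply Rle_0_sqr.
  assert (0 <= sin x * sin x) by apply Rle_0_sqr. simpl; lra.
Qed.

Lemma ellipticF_radicand_pos (m x : R) : m < 1 -> 0 < 1 - m * sin x ^ 2.
Proof. intros Hm. assert (H := sin_sq_le_1 x). destruct (Rle_dec m 0); nra. Qed.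

Lemma continuous_ellipticF_integrand (m x : R) :
  m < 1 -> continuous (fun theta => / sqrt (1 - m * sin theta ^ 2)) x.
Proof.
  intros Hm. apply (ex_derive_continuous (V := R_NormedModule)).
  assert (H := ellipticF_radicand_pos m x Hm).
  auto_derive. repeat split; simpl in *; try lra.
  apply Rgt_not_eq, sqrt_lt_R0. simpl in *; lra.
Qed.

Lemma ellipticF_increasing (m x y : R) :
  m < 1 -> x < y -> ellipticF x m < ellipticF y m.
Proof.
  intros Hm. apply primitive_increasing.
  - intros z. now apply continuous_ellipticF_integrand.
  - intros z. now apply Rinv_0_lt_compat, sqrt_lt_R0, ellipticF_radicand_pos.
Qed.

(** * The trigonometric substitution *)

Definition tau_of (phi : R) : R :=
  sin phi * sqrt (1 - 1 / 4 * sin phi ^ 2) / cos phi.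

Definition dtau_of (phi : R) : R :=
  (1 - sin phi ^ 2 / 2 + sin phi ^ 4 / 4)
  / (cos phi ^ 2 * sqrt (1 - 1 / 4 * sin phi ^ 2)).

Lemma is_derive_tau_of (phi : R) :
  cos phi <> 0 -> is_derive tau_of phi (dtau_of phi).
Proof.
  intros Hc.
  assert (Hr := ellipticF_radicand_pos (1 / 4) phi ltac:(lra)).
  assert (Hd := sqrt_lt_R0 _ Hr).
  unfold tau_of, dtau_of. auto_derive.
  - split; [| now split].
    replace (1 + _) with (1 - 1 / 4 * sin phi ^ 2) by (simpl; ring).
    exact Hr.
  - replace (1 + - (1 / 4 * (sin phi * (sin phi * 1))))
      with (1 - 1 / 4 * sin phi ^ 2) by (simpl; ring).
    set (d := sqrt (1 - 1 / 4 * sin phi ^ 2)) in *.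
    assert (Ed : d ^ 2 = 1 - 1 / 4 * sin phi ^ 2) by (apply pow2_sqrt; lra).
    assert (Ec : cos phi ^ 2 = 1 - sin phi ^ 2).
    { assert (H := sin2_cos2 phi). unfold Rsqr in H. simpl; lra. }
    set (s := sin phi) in *. set (c := cos phi) in *.
    (* Once denominators are cleared, the equation follows from the relations for [c ^ 2] and
       [d ^ 2]. *)
    field_simplify_eq; [| lra].
    rewrite Ec, Ed. field.
Qed.

(** With [x = sin phi ^ 2] and [y = x * (1 - x / 4)], the square of [tau_of phi] is [y / (1 - x)],
    and [(1 - x) ^ 2 + y * (1 - x) + y ^ 2 = (1 - x / 2 + x ^ 2 / 4) ^ 2]. The root is the
    nonnegative one since [0 <= x <= 1]. *)
Lemma tau_of_radicand (phi : R) :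
  cos phi <> 0 ->
  sqrt (1 + tau_of phi ^ 2 + tau_of phi ^ 4)
  = (1 - sin phi ^ 2 / 2 + sin phi ^ 4 / 4) / cos phi ^ 2.
Proof.
  intros Hc.
  assert (Hr := ellipticF_radicand_pos (1 / 4) phi ltac:(lra)).
  assert (Ec : cos phi ^ 2 = 1 - sin phi ^ 2).
  { assert (H := sin2_cos2 phi). unfold Rsqr in H. simpl; lra. }
  assert (Hc2 : 0 < cos phi ^ 2) by now apply pow2_gt_0.
  assert (Hs := sin_sq_le_1 phi).
  assert (E : tau_of phi ^ 2
    = sin phi ^ 2 * (1 - 1 / 4 * sin phi ^ 2) / cos phi ^ 2).
  { unfold tau_of. set (d := sqrt _).
    assert (Ed : d ^ 2 = 1 - 1 / 4 * sin phi ^ 2) by (apply pow2_sqrt; lra).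
    rewrite <- Ed. now field. }
  replace (tau_of phi ^ 4) with ((tau_of phi ^ 2) ^ 2) by ring.
  replace (sin phi ^ 4) with ((sin phi ^ 2) ^ 2) by ring.
  rewrite E, Ec in *. set (x := sin phi ^ 2) in *.
  apply sqrt_lem_1.
  - rewrite <- E. assert (H := xi_radicand_pos (tau_of phi)).
    replace ((tau_of phi ^ 2) ^ 2) with (tau_of phi ^ 4) by ring. lra.
  - apply Rdiv_le_0_compat; nra.
  - field. lra.
Qed.

(** The [Rmin]/[Rmax] form matches the side conditions of [RInt_comp], so that [phi] may have either
    sign. *)
Lemma cos_pos_between (a b x : R) :
  - (PI / 2) < a < PI / 2 -> - (PI / 2) < b < PI / 2 ->
  Rmin a b <= x <= Rmax a b -> 0 < cos x.
Proof.
  intros Ha Hb Hx. apply cos_gt_0;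
    unfold Rmin, Rmax in Hx; destruct (Rle_dec a b); lra.
Qed.

Lemma tau_of_0 : tau_of 0 = 0.
Proof. unfold tau_of. rewrite sin_0. unfold Rdiv. ring. Qed.

Lemma xi_tau_of (phi : R) :
  - (PI / 2) < phi < PI / 2 -> xi (tau_of phi) = ellipticF phi (1 / 4).
Proof.
  intros Hphi. assert (HPI := PI_RGT_0).
  assert (Hcos : forall x, Rmin 0 phi <= x <= Rmax 0 phi -> cos x <> 0).
  { intros x Hx. apply Rgt_not_eq.
    apply (cos_pos_between 0 phi x); auto; lra. }
  (* The lower limit becomes [tau_of 0], as the change of variables requires. *)
  unfold xi, ellipticF. rewrite <- tau_of_0 at 1.
  rewrite <- (RInt_comp _ tau_of dtau_of).
  - apply RInt_ext. intros x Hx.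
    assert (Hc : cos x <> 0) by (apply Hcos; lra).
    rewrite tau_of_radicand by assumption.
    assert (Hd := sqrt_lt_R0 _ (ellipticF_radicand_pos (1 / 4) x ltac:(lra))).
    assert (Hs := sin_sq_le_1 x).
    unfold scal; simpl; unfold mult; simpl. unfold dtau_of.
    replace (sin x ^ 4) with ((sin x ^ 2) ^ 2) by ring.
    simpl in *. field. repeat split; auto; nra.
  - intros x _. apply continuous_xi_integrand.
  - intros x Hx. assert (Hc := Hcos x Hx). split.
    + now apply is_derive_tau_of.
    + assert (Hr := ellipticF_radicand_pos (1 / 4) x ltac:(lra)).
      assert (Hd := sqrt_lt_R0 _ Hr).
      apply (ex_derive_continuous (V := R_NormedModule)).
      unfold dtau_of. auto_derive. simpl in *.
      repeat split; try lra.
      apply Rmult_integral_contrapositive; split; [| unfold Rdiv, Rminus in *; lra].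
      nra.
Qed.

(** * The substitution maps onto the real line *)

Lemma tau_of_opp (phi : R) : tau_of (- phi) = - tau_of phi.
Proof.
  unfold tau_of. rewrite sin_neg, cos_neg.
  replace ((- sin phi) ^ 2) with (sin phi ^ 2) by ring.
  unfold Rdiv. ring.
Qed.

(** The radicand is at least 3/4, hence at least [(1 / 2) ^ 2]. This crude bound already makes
    [tau_of] unbounded near [PI / 2]. *)
Lemma half_tan_le_tau_of (phi : R) :
  0 <= phi < PI / 2 -> tan phi / 2 <= tau_of phi.
Proof.
  intros Hphi.
  assert (Hc : 0 < cos phi) by (apply cos_gt_0; lra).
  assert (Hs : 0 <= sin phi) by (apply sin_ge_0; lra).
  assert (Hd : 1 / 2 <= sqrt (1 - 1 / 4 * sin phi ^ 2)).
  { rewrite <- (sqrt_pow2 (1 / 2)) by lra. apply sqrt_le_1_alt.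
    assert (H := sin_sq_le_1 phi). simpl in *. lra. }
  unfold tau_of, tan.
  replace (sin phi / cos phi / 2) with (sin phi * (1 / 2) / cos phi)
    by (field; lra).
  apply Rmult_le_compat_r; [apply Rlt_le, Rinv_0_lt_compat, Hc |].
  now apply Rmult_le_compat_l.
Qed.

Lemma tau_of_surjective (t : R) :
  exists phi, - (PI / 2) < phi < PI / 2 /\ tau_of phi = t.
Proof.
  (* Chosen so that [tan a / 2 = Rabs t + 1], which exceeds [Rabs t]; by oddness, [t] then lies
     between the values of [tau_of] at [- a] and [a]. *)
  set (a := atan (2 * (Rabs t + 1))).
  assert (Ha : a < PI / 2) by apply atan_bound.
  assert (Ha0 : 0 < a).
  { rewrite <- atan_0. apply atan_increasing. assert (H := Rabs_pos t). lra. }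
  assert (Hta : Rabs t < tau_of a).
  { assert (H := half_tan_le_tau_of a ltac:(lra)).
    unfold a in H at 1. rewrite tan_atan in H. lra. }
  destruct (IVT_interv (fun x => tau_of x - t) (- a) a) as [phi [Hphi E]].
  - intros x Hx. apply continuity_pt_filterlim.
    apply (continuous_minus (V := R_NormedModule)); [| apply continuous_const].
    apply (ex_derive_continuous (V := R_NormedModule)).
    exists (dtau_of x). apply is_derive_tau_of, Rgt_not_eq, cos_gt_0; lra.
  - lra.
  - rewrite tau_of_opp. apply Rabs_def2 in Hta. lra.
  - apply Rabs_def2 in Hta. lra.
  - exists phi. split; lra.
Qed.

(** * The range of [xi] and the value of [p0] *)

Lemma xi_bounded (t : R) : xi t <= ellipticF (PI / 2) (1 / 4).
Proof.
  destruct (tau_of_surjective t) as [phi [Hphi <-]].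
  rewrite xi_tau_of by assumption.
  apply Rlt_le, ellipticF_increasing; lra.
Qed.

(** As [xi] is increasing and bounded, the improper integral converges to the supremum of its
    values. This turns the hypothesis on [u] into bounds by values of [xi]. *)
Lemma p0_is_lub : is_lub (fun y => exists t, y = xi t) p0.
Proof.
  destruct (completeness (fun y => exists t, y = xi t)) as [l Hl].
  - exists (ellipticF (PI / 2) (1 / 4)). intros y [t ->]. apply xi_bounded.
  - now exists (xi 0), 0.
  - replace p0 with l; [exact Hl |].
    symmetry. apply (is_RInt_gen_unique (V := R_CompleteNormedModule)).
    destruct Hl as [Hub Hlub]. intros P [eps Heps].
    assert (HM : exists M, l - eps < xi M).
    { apply Classical_Prop.NNPP. intros Hn.
      assert (l <= l - eps).
      { apply Hlub. intros y [t ->]. apply Rnot_lt_le. intros Ht.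
        apply Hn. now exists t. }
      assert (H0 := cond_pos eps). lra. }
    destruct HM as [M HM].
    (* For [b > M], monotonicity gives [l - eps < xi M < xi b <= l]. *)
    exists (fun a => a = 0) (fun b => M < b).
    + reflexivity.
    + now exists M.
    + intros a b -> Hb. exists (xi b). split.
      * apply (RInt_correct (V := R_CompleteNormedModule)).
        apply ex_RInt_everywhere_continuous, continuous_xi_integrand.
      * apply Heps. apply xi_increasing in Hb.
        assert (xi b <= l) by (apply Hub; now exists b).
        apply Rabs_def1; unfold minus, plus, opp; simpl; lra.
Qed.

Lemma xi_gt_of_lt_p0 (u : R) : u < p0 -> exists t, u < xi t.
Proof.
  intros Hu. apply Classical_Prop.NNPP. intros Hn.
  assert (p0 <= u); [| lra].
  apply p0_is_lub. intros y [t ->]. apply Rnot_lt_le. intros Ht.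
  apply Hn. now exists t.
Qed.

(** Intermediate value theorem; the lower endpoint comes from applying the supremum property to
    [- u] and using oddness. *)
Lemma xi_surjective (u : R) : - p0 < u < p0 -> exists t, xi t = u.
Proof.
  intros Hu.
  destruct (xi_gt_of_lt_p0 u) as [b Hb]; [lra |].
  destruct (xi_gt_of_lt_p0 (- u)) as [a Ha]; [lra |].
  assert (Ha' : xi (- a) < u) by (rewrite xi_opp; lra).
  assert (Hab : - a < b).
  { apply Rnot_le_lt. intros [H | H].
    - apply xi_increasing in H. lra.
    - rewrite H in Hb. lra. }
  destruct (IVT_interv (fun x => xi x - u) (- a) b) as [t [_ E]]; try lra.
  - intros x _. apply continuity_pt_filterlim.
    apply (continuous_minus (V := R_NormedModule)); [| apply continuous_const].
    apply (ex_derive_continuous (V := R_NormedModule)).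
    eexists. apply is_derive_xi.
  - exists t. lra.
Qed.

Theorem mainTheorem3 (u : R) (hu : - p0 < u < p0) :
  calE u = sn u (1 / 4) * dn u (1 / 4) / cn u (1 / 4).
Proof.
  destruct (xi_surjective u hu) as [t <-].
  destruct (tau_of_surjective t) as [phi [Hphi <-]].
  assert (Eam : am (xi (tau_of phi)) (1 / 4) = phi).
  (* The argument equals [ellipticF phi (1 / 4)], and [ellipticF] is injective in its amplitude. *)
  { rewrite xi_tau_of by assumption. unfold am.
    apply (inverse_injective (fun phi => ellipticF phi (1 / 4))).
    apply strictly_increasing_injective. intros x y.
    apply ellipticF_increasing. lra. }
  unfold sn, cn, dn. rewrite Eam.
  (* The right-hand side is now [tau_of phi] by definition, so only the injectivity of [xi] is
     left. *)
  apply inverse_injective, strictly_increasing_injective, xi_increasing.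
Qed.
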